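(* Let $D_1,\dots,D_k$ be oriented graphs with $\operatorname{inv}(D_i)=1$ for all $i$, and let $\widehat{D}=[D_1,\dots,D_k]$ be their $k$-join. Then sets $X_1,\dots,X_k\subseteq V(\widehat{D})$ form a decycling family of $\widehat{D}$ if and only if there are orthonormal vectors $\mathbf{u}_1,\dots,\mathbf{u}_k\in\mathbb{F}_2^k$ and, for each $i$, a decycling set $V_i\subseteq V(D_i)$ of the $i$th factor of $\widehat{D}$ such that, for each $i$, the vertices in $V_i$ have characteristic vector $\mathbf{u}_i$ in $X_1,\dots,X_k$, and all other vertices of $\widehat{D}$ have characteristic vector $\mathbf{0}$ in $X_1,\dots,X_k$. In particular, any acyclic digraph obtained from $\widehat{D}$ by $k$ inversions can also be obtained by inverting a decycling set for each factor in turn.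
   Context: All digraphs are oriented graphs: directed graphs without loops, digons or parallel edges. For a digraph $D$ and $X\subseteq V(D)$, inverting $X$ in $D$ means reversing the direction of every edge with both endpoints in $X$. A family $X_1,\dots,X_k\subseteq V(D)$ is a decycling family of $D$ if inverting $X_1,\dots,X_k$ in turn yields an acyclic digraph; a single set forming a decycling family on its own is a decycling set. $\operatorname{inv}(D)$ is the minimum size of a decycling family of $D$. The $k$-join $[D_1,\dots,D_k]$ consists of vertex-disjoint copies of $D_1,\dots,D_k$ together with an edge $\vec{uv}$ whenever $u\in V(D_i)$, $v\in V(D_j)$, $i<j$; the canonical copy of $D_i$ is the $i$th factor. The characteristic vector of a vertex $v$ in $X_1,\dots,X_k$ is $(I_{\{v\in X_i\}}:i\in[k])\in\mathbb{F}_2^k$. For $\mathbf{u},\mathbf{v}\in\mathbb{F}_2^k$, $\mathbf{u}\cdot\mathbf{v}$ is the standard scalar product over $\mathbb{F}_2$; vectors $\mathbf{u}_1,\dots,\mathbf{u}_\ell$ are orthonormal if $\mathbf{u}_i\cdot\mathbf{u}_i=1$ for all $i$ and $\mathbf{u}_i\cdot\mathbf{u}_j=0$ for $i\neq j$. *)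

(* Defs.v *)
From mathcomp Require Import all_boot all_algebra.

Set Implicit Arguments.
Unset Strict Implicit.
Unset Printing Implicit Defensive.

Import GRing.Theory.
Local Open Scope ring_scope.

(* The case [u = v] of the axiom excludes loops; a relation has no parallel
   edges. *)
Record ograph (V : finType) := OGraph {
  edge :> rel V;
  edge_asym : forall u v : V, edge u v -> ~~ edge v u }.

Section Inversion.
Variable V : finType.
Implicit Types (D : ograph V) (X : {set V}) (Xs : seq {set V}).

(* A cycle without repeated vertices has at most #|V| vertices, so the bound
   on the length loses nothing: see [acyclicP]. *)
Definition acyclic D : bool :=
  ~~ [exists n : 'I_#|V|, exists c : n.+1.-tuple V, ucycleb D c].

Lemma acyclicP D :
  reflect (forall c : seq V, ucycle D c -> c = [::]) (acyclic D).
Proof.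
apply: (iffP existsPn) => [acD c ucc | acD n].
  case: c ucc => // x c ucc.
  have lt_c : (size c < #|V|)%N.
    have /andP[_ uc] := ucc; rewrite -[(size c).+1]/(size (x :: c)).
    by rewrite -(card_uniqP uc) max_card.
  have /existsPn/(_ (in_tuple (x :: c))) := acD (Ordinal lt_c).
  by rewrite /= [ucycleb _ _]ucc.
apply/existsPn => c; apply/negP => /acD c0.
by have := size_tuple c; rewrite c0.
Qed.

Definition invert_rel D X : rel V :=
  fun u v => if (u \in X) && (v \in X) then D v u else D u v.

Lemma invert_asym D X u v : invert_rel D X u v -> ~~ invert_rel D X v u.
Proof. by rewrite /invert_rel andbC; case: ifP => _ /edge_asym. Qed.

Definition invert D X : ograph V := OGraph (@invert_asym D X).

Definition inverts D Xs : ograph V := foldl invert D Xs.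

Definition decycling_family D Xs : bool := acyclic (inverts D Xs).

Definition decycling_set D X : bool := decycling_family D [:: X].

(* Inverting the pairs {u, v} one by one reverses all the edges that are
   decreasing for the enumeration order of V. *)
Lemma exists_decycling_family D :
  exists n, [exists Xs : n.-tuple {set V}, decycling_family D Xs].
Proof.
suff [Xs acXs] : exists Xs : seq {set V}, decycling_family D Xs.
  by exists (size Xs); apply/existsP; exists (in_tuple Xs).
pose bad (E : ograph V) :=
  [set p : V * V | E p.1 p.2 && (enum_rank p.2 < enum_rank p.1)%N].
have [m] := ubnP #|bad D|; elim: m D => // m IHm D ltDm.
have [bad0 | [[u v] uv_bad]] := set_0Vmem (bad D).
  exists [::]; apply/acyclicP => -[//|x c] /andP[cyc _].
  have sub_lt : subrel D (fun x y => enum_rank x <= enum_rank y)%N.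
    move=> y z Dyz; rewrite leqNgt; apply/negP => lt_zy.
    have : (y, z) \in bad D by rewrite inE /= Dyz.
    by rewrite bad0 inE.
  have neqD y z : D y z -> y != z.
    move=> Dyz; apply/eqP => eyz; subst z.
    by have := edge_asym Dyz; rewrite Dyz.
  have sub_lts : subrel D (fun x y => enum_rank x < enum_rank y)%N.
    move=> y z Dyz; rewrite ltn_neqAle sub_lt // andbT.
    by rewrite (inj_eq val_inj) (inj_eq enum_rank_inj) neqD.
  have tr : transitive (fun x y : V => enum_rank x < enum_rank y)%N.
    by move=> y z t; apply: ltn_trans.
  have := sub_path sub_lts cyc; move/(order_path_min tr)/allP/(_ x).
  by rewrite mem_rcons mem_head ltnn => /(_ isT).
have /IHm[Xs acXs] : (#|bad (invert D [set u; v])| < m)%N.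
  rewrite -ltnS; apply: leq_trans ltDm; rewrite ltnS.
  move: uv_bad; rewrite inE /= => /andP[Duv lt_vu].
  apply: proper_card; apply/properP; split.
    apply/subsetP => -[y z]; rewrite !inE /= /invert_rel !inE.
    case: ifP => // /andP[/orP[]/eqP-> /orP[]/eqP->].
    - by [].
    - by rewrite (negPf (edge_asym Duv)).
    - by rewrite ltnNge (ltnW lt_vu) andbF.
    - by [].
  exists (u, v); first by rewrite inE /= Duv.
  by rewrite inE /= /invert_rel !inE !eqxx orbT /= (negPf (edge_asym Duv)).
by exists ([set u; v] :: Xs).
Qed.

Definition inversion_number D : nat := ex_minn (exists_decycling_family D).

End Inversion.

Section Join.
Variables (k : nat) (V : 'I_k -> finType) (D : forall i, ograph (V i)).

(* The vertex [Tagged V v] with [v : V i] is the copy of [v] in the ith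
   factor. *)
Definition kjoin_rel : rel {i : 'I_k & V i} :=
  fun x y => (tag x < tag y)%N
    || (tag x == tag y) && D (tag x) (tagged x) (tagged_as x y).

Lemma kjoin_asym x y : kjoin_rel x y -> ~~ kjoin_rel y x.
Proof.
case: x y => [i x] [j y]; rewrite /kjoin_rel /=.
have [eij | neij] := eqVneq i j.
  by subst j; rewrite !tagged_asE ltnn /=; apply: edge_asym.
rewrite orbF /= orbF -leqNgt; exact: ltnW.
Qed.

Definition kjoin : ograph {i : 'I_k & V i} := OGraph kjoin_asym.

Definition factor_set (i : 'I_k) (W : {set V i}) : {set {i : 'I_k & V i}} :=
  [set Tagged V v | v in W].

End Join.

Definition charvec (T : finType) (k : nat) (X : k.-tuple {set T}) (v : T) :
    'rV['F_2]_k :=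
  \row_(i < k) (v \in tnth X i)%:R.

Definition dotp (k : nat) (u v : 'rV['F_2]_k) : 'F_2 :=
  \sum_(j < k) u 0 j * v 0 j.

Definition orthonormal_family (k l : nat) (u : 'I_l -> 'rV['F_2]_k) : Prop :=
  (forall i, dotp (u i) (u i) = 1) /\
  (forall i j, i != j -> dotp (u i) (u j) = 0).

(* Main.v *)
(* Let r be a topological rank of the inverted k-join and let c be the
   characteristic vectors, so that an edge uv is reversed iff c u . c v = 1.
   In each D_i take a cycle, its r-last vertex b_i, and the predecessor p_i and
   successor s_i of b_i on it: then c p_i . c b_i = 0 and c s_i . c b_i = 1,
   while p_i and s_i have the same product with every b_j after b_i.  Hence the
   vectors c b_i are independent and form a basis of F_2^k.

   Factors are now peeled off in the order of the b_i.  If b_m is the first,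
   let f be the vector with f . c b_m = 1 that is orthogonal to all the other
   b_j.  The vertices of D_m up to b_m have vector c b_m or c b_m + f.  If a
   vertex y of another factor had c y . f = 1, its place in the final order
   would separate these two classes, which the cycle of D_m must cross in both
   directions although all edges between them are treated alike.  So the other
   factors live in the orthogonal of f, and f . f = 1 by independence.  By
   induction their vectors are 0 or u_j, with (u_j) orthonormal.  Finally a
   vertex x of D_m with c x . u_j = 1 would separate the vertices of D_j with
   vector 0 from those with vector u_j, so c x is 0 or f. *)
Require Import Defs.
From mathcomp Require Import all_boot all_algebra.

Set Implicit Arguments.
Unset Strict Implicit.
Unset Printing Implicit Defensive.

Import GRing.Theory.
Local Open Scope ring_scope.

(** * Arithmetic in ['F_2] *)

Lemma F2_cases (a : 'F_2) : a = 0 \/ a = 1.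
Proof. by case: a => -[|[|//]] lt_a; [left | right]; apply: val_inj. Qed.

Lemma F2_addrr (a : 'F_2) : a + a = 0.
Proof. by case: (F2_cases a) => ->; apply: val_inj. Qed.

Lemma F2_natr_odd (n : nat) : n%:R = (odd n)%:R :> 'F_2.
Proof.
elim: n => [//|n IHn]; rewrite mulrS {}IHn /=.
by case: (odd n); apply: val_inj.
Qed.

Lemma F2_natr_inj (a b : bool) : a%:R = b%:R :> 'F_2 -> a = b.
Proof. by case: a; case: b. Qed.

(** * The scalar product and bases over ['F_2] *)

Section Dotp.
Variable k : nat.
Implicit Types (u v w : 'rV['F_2]_k).

Lemma dotpE u v : dotp u v = (u *m v^T) 0 0.
Proof. by rewrite mxE; apply: eq_bigr => j _; rewrite mxE. Qed.

Lemma dotpC u v : dotp u v = dotp v u.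
Proof. by apply: eq_bigr => j _; rewrite mulrC. Qed.

Lemma dotpDl u v w : dotp (u + v) w = dotp u w + dotp v w.
Proof. by rewrite !dotpE mulmxDl mxE. Qed.

Lemma dotpZl a u w : dotp (a *: u) w = a * dotp u w.
Proof. by rewrite !dotpE -scalemxAl mxE. Qed.

Lemma dotp0l w : dotp 0 w = 0.
Proof. by rewrite dotpE mul0mx mxE. Qed.

Lemma dotpDr u v w : dotp w (u + v) = dotp w u + dotp w v.
Proof. by rewrite !(dotpC w) dotpDl. Qed.

Lemma dotp_suml (I : finType) (f : I -> 'rV['F_2]_k) w :
  dotp (\sum_i f i) w = \sum_i dotp (f i) w.
Proof.
by apply: (big_morph (fun v => dotp v w)) => [u v|]; rewrite (dotpDl, dotp0l).
Qed.

Lemma F2_row_addr_eq0 u v : u + v = 0 -> u = v.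
Proof.
move=> /eqP; rewrite addr_eq0 => /eqP ->; apply/rowP => i; rewrite mxE.
by apply/eqP; rewrite eq_sym -addr_eq0 F2_addrr.
Qed.

Variable w : 'I_k -> 'rV['F_2]_k.
Let W : 'M_k := \matrix_i w i.

Let dotpW v i : dotp v (w i) = (v *m W^T) 0 i.
Proof. by rewrite mxE; apply: eq_bigr => j _; rewrite !mxE. Qed.

Hypothesis free_w :
  forall c : 'I_k -> 'F_2, \sum_i c i *: w i = 0 -> forall i, c i = 0.

Let unitW : W \in unitmx.
Proof.
rewrite -row_free_unit; apply: inj_row_free => v; rewrite mulmx_sum_row => v0.
apply/rowP => i; rewrite mxE; apply: (free_w (c := v 0)).
by rewrite -[RHS]v0; apply: eq_bigr => j _; rewrite rowK.
Qed.

(** Being [k] independent rows, the [w i] make [W] invertible; [e] is row [m] of the inverse of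
    [W^T]. *)
Lemma free_dual m : exists e, forall i, dotp e (w i) = (i == m)%:R.
Proof.
exists (delta_mx 0 m *m invmx W^T) => i.
by rewrite dotpW mulmxKV ?unitmx_tr // mxE eqxx.
Qed.

Lemma free_separates v : (forall i, dotp v (w i) = 0) -> v = 0.
Proof.
move=> v0; have {}v0: v *m W^T = 0 by apply/rowP => i; rewrite -dotpW v0 mxE.
have unitWt : W^T \in unitmx by rewrite unitmx_tr.
by rewrite -(mulmxK unitWt v) v0 mul0mx.
Qed.

Lemma free_span v : exists c : 'I_k -> 'F_2, v = \sum_i c i *: w i.
Proof.
exists ((v *m invmx W) 0); rewrite -[LHS](mulmxKV unitW) mulmx_sum_row.
by apply: eq_bigr => i _; rewrite rowK.
Qed.

End Dotp.

(** Pairing a vanishing combination with [u i] isolates its [i]th coefficient, so the [u i] form a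
    basis. *)
Lemma orthonormal_separates k (u : 'I_k -> 'rV['F_2]_k) v :
    (forall i j, dotp (u i) (u j) = (i == j)%:R) ->
  (forall i, dotp v (u i) = 0) -> v = 0.
Proof.
move=> onu; apply: free_separates => c c0 i.
have := dotp0l (u i); rewrite -{1}c0 dotp_suml (bigD1 i) //= big1 => [|j ji].
  by rewrite dotpZl onu eqxx mulr1 addr0.
by rewrite dotpZl onu (negPf ji) mulr0.
Qed.

(** * Cycles and topological ranks *)

Section Acyclic.
Variable V : finType.
Implicit Types (D : ograph V) (c : seq V) (P : pred V).

(** After rotating [c] to start at [x], [P] propagates along the path. Closure is asked only on [c],
    since it will be known only there. *)
Lemma cycle_closed (e : rel V) c P x y :
    cycle e c -> {in c &, forall y z, e y z -> P y -> P z} ->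
  x \in c -> P x -> y \in c -> P y.
Proof.
move=> cyc clP xc Px; have [n p def_c] := rot_to xc.
have mc z : (z \in c) = (z \in x :: p) by rewrite -def_c mem_rot.
move: cyc; rewrite -(rot_cycle n) def_c /= rcons_path => /andP[pth _].
have {mc} sp : {subset x :: p <= c} by move=> z; rewrite mc.
have -> : (y \in c) = (y \in x :: p) by rewrite -def_c mem_rot.
elim: p x Px pth {xc def_c} sp => [|z p IHp] x Px /=.
  by move=> _ _; rewrite inE => /eqP ->.
case/andP=> xz pth sp; rewrite inE => /predU1P[-> // | ].
have sp' : {subset z :: p <= c} by move=> t tp; apply: sp; rewrite inE tp orbT.
apply: IHp => //; apply: clP Px => //; first by rewrite sp ?mem_head.
by rewrite sp' ?mem_head.
Qed.

Lemma not_acyclic_cycle D :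
  ~~ acyclic D -> exists2 c, cycle D c & exists b, b \in c.
Proof.
rewrite negbK => /existsP[n /existsP[c /andP[cyc _]]]; exists c => //.
by exists (tnth c ord0); rewrite mem_tnth.
Qed.

Lemma rank_acyclic D (r : V -> nat) :
  (forall u v, D u v -> (r u < r v)%N) -> acyclic D.
Proof.
move=> rD; apply/acyclicP => -[//|x c] /andP[cyc _].
have sub : subrel D (fun u v => r u < r v)%N by move=> u v /rD.
have tr : transitive (fun u v => r u < r v)%N by move=> u v w; apply: ltn_trans.
have /(order_path_min tr)/allP/(_ x) := sub_path sub cyc.
by rewrite mem_rcons mem_head ltnn => /(_ isT).
Qed.

(** The rank counts ancestors: along an edge [u v] those of [u] remain, and [v] is new because a
    path from [v] to [u] would close a cycle. *)
Lemma acyclic_rank D :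
  acyclic D -> exists r : V -> nat, forall u v, D u v -> (r u < r v)%N.
Proof.
move=> /acyclicP acD; exists (fun v => #|[set u | connect D u v]|) => u v Duv.
apply: proper_card; apply/properP; split.
  by apply/subsetP => w; rewrite !inE => /connect_trans; apply; apply: connect1.
exists v; rewrite !inE ?connect0 //; apply/negP => /connectP[p pth def_u].
move: Duv; rewrite {u}def_u; case/shortenP: pth => p' pth' uq _ Duv.
by have /acD : ucycle D (v :: p') by rewrite /ucycle /= rcons_path pth' Duv.
Qed.

End Acyclic.

(** * Vectors of a ranked join *)

Section RankedJoin.
Variables (k : nat) (V : 'I_k -> finType) (D : forall i, ograph (V i)).
Variables (c : forall i, V i -> 'rV['F_2]_k) (r : forall i, V i -> nat).
Arguments c {i}.
Arguments r {i}.

Hypothesis rank_edge : forall i (x y : V i), D i x y ->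
  if dotp (c x) (c y) == 0 then (r x < r y)%N else (r y < r x)%N.
Hypothesis rank_join : forall i j (x : V i) (y : V j), (i < j)%N ->
  if dotp (c x) (c y) == 0 then (r x < r y)%N else (r y < r x)%N.

Lemma rank_neq i j (x : V i) (y : V j) : i != j -> r x != r y.
Proof.
move=> ij; have [lt_ij | lt_ji | eq_ij] := ltngtP i j.
- by have := rank_join x y lt_ij; case: ifP => _; case: ltngtP.
- by have := rank_join y x lt_ji; case: ifP => _; case: ltngtP.
- by rewrite (val_inj eq_ij) eqxx in ij.
Qed.

(** An edge between factors is reversed exactly when the final order disagrees with the order of the
    factors. *)
Lemma dotp_join i j (x : V i) (y : V j) : i != j ->
  dotp (c x) (c y) = ((i < j)%N (+) (r x < r y)%N)%:R.
Proof.
move=> ij; have := rank_neq x y ij.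
have [lt_ij | lt_ji | eq_ij] := ltngtP i j.
- have := rank_join x y lt_ij.
  by case: (F2_cases (dotp (c x) (c y))) => -> /=; case: ltngtP.
- have := rank_join y x lt_ji; rewrite dotpC.
  by case: (F2_cases (dotp (c x) (c y))) => -> /=; case: ltngtP.
- by rewrite (val_inj eq_ij) eqxx in ij.
Qed.

(* If all cross pairs of a bipartition have the same product, then the edges
   between the two parts are all reversed or all kept; as one part precedes
   the other in the final order, a cycle of [D i] cannot cross twice. *)
Lemma cycle_not_separated i (q : seq (V i)) (P : pred (V i)) (t : 'F_2) x0 y0 :
    cycle (D i) q -> x0 \in q -> P x0 -> y0 \in q -> ~~ P y0 ->
    {in q &, forall x y, P x -> ~~ P y ->
       dotp (c x) (c y) = t /\ (r x < r y)%N} ->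
  False.
Proof.
move=> cyc qx0 Px0 qy0 nPy0 sepP.
have [t0 | t1] := F2_cases t.
  suff : ~~ P x0 by rewrite Px0.
  apply: (cycle_closed (P := predC P)) cyc _ qy0 nPy0 qx0 => y z qy qz Dyz nPy.
  apply/negP => Pz; have [dzy lt_zy] := sepP z y qz qy Pz nPy.
  by have := rank_edge Dyz; rewrite dotpC dzy t0 eqxx ltnNge ltnW.
suff : P y0 by rewrite (negPf nPy0).
apply: cycle_closed cyc _ qx0 Px0 qy0 => y z qy qz Dyz Py.
case: (boolP (P z)) => // nPz; have [dyz lt_yz] := sepP y z qy qz Py nPz.
by have := rank_edge Dyz; rewrite dyz t1 /= ltnNge ltnW.
Qed.

(* [b] is the last vertex of the cycle [q] in the final order, [p] and [s] are
   its predecessor and its successor on [q]. *)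
Record turn i (q : seq (V i)) (p s b : V i) : Prop := Turn {
  turn_cycle : cycle (D i) q;
  turn_p : p \in q;
  turn_s : s \in q;
  turn_b : b \in q;
  turn_max : {in q, forall x, (r x <= r b)%N};
  turn_dotp : dotp (c p) (c b) = 0;
  turn_dots : dotp (c s) (c b) = 1 }.

(** At the last vertex of a cycle the incoming edge must be kept and the outgoing one reversed. *)
Lemma exists_turn i :
  ~~ acyclic (D i) -> exists t : seq (V i) * (V i * V i * V i),
    turn t.1 t.2.1.1 t.2.1.2 t.2.2.
Proof.
case/not_acyclic_cycle=> q cyc [x0 qx0].
case: (arg_maxnP (P := mem q) (fun x => r x) qx0) => b qb maxb'.
have maxb x : x \in q -> (r x <= r b)%N by apply: maxb'.
exists (q, (prev q b, next q b, b)); split => //=.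
- by rewrite mem_prev.
- by rewrite mem_next.
- have := rank_edge (prev_cycle cyc qb).
  case: (F2_cases (dotp (c (prev q b)) (c b))) => -> //=.
  by rewrite ltnNge maxb // mem_prev.
- have := rank_edge (next_cycle cyc qb); rewrite dotpC.
  case: (F2_cases (dotp (c (next q b)) (c b))) => -> //=.
  by rewrite ltnNge maxb // mem_next.
Qed.

(** * Peeling off the factors *)

Section Peel.
Variables (q : forall i, seq (V i)) (p s b : forall i, V i).
Hypothesis turnP : forall i, turn (q i) (p i) (s i) (b i).

Let delta i := c (p i) + c (s i).

Let dotp_delta_b i : dotp (c (b i)) (delta i) = 1.
Proof.
have [_ _ _ _ _ dp ds] := turnP i.
by rewrite dotpDr !(dotpC (c (b i))) dp ds add0r.
Qed.

(** Both [p j] and [s j] precede [b i], so their products with it agree and cancel. *)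
Let dotp_delta_later i j :
  i != j -> (r (b j) < r (b i))%N -> dotp (c (b i)) (delta j) = 0.
Proof.
move=> ij lt_ji; have [_ qp qs _ maxb _ _] := turnP j.
rewrite dotpDr !dotp_join // !(ltnNge (r (b i))).
by rewrite !(ltnW (leq_ltn_trans (maxb _ _) lt_ji)) // F2_addrr.
Qed.

Section Step.
(** [J] holds the factors still to be peeled; for [i] outside [J], [e i] is the vector already
    found. *)
Variables (J : {set 'I_k}) (e : 'I_k -> 'rV['F_2]_k).
Hypothesis on_e : forall i j, i \notin J -> j \notin J ->
  dotp (e i) (e j) = (i == j)%:R.
Hypothesis perp_e : forall i j (x : V j), i \notin J -> j \in J ->
  dotp (c x) (e i) = 0.

Let w i := if i \in J then c (b i) else e i.

Let dotp_w_e (a : 'I_k -> 'F_2) i :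
  i \notin J -> dotp (\sum_j a j *: w j) (e i) = a i.
Proof.
move=> nJi; rewrite dotp_suml (bigD1 i) //= big1 => [|j ji].
  by rewrite dotpZl /w (negPf nJi) on_e // eqxx mulr1 addr0.
rewrite dotpZl /w; case: ifP => [Jj | /negbT nJj].
  by rewrite perp_e // mulr0.
by rewrite on_e // (negPf ji) mulr0.
Qed.

(* The products of the vectors [c (b i)] and [delta j] form a unitriangular
   matrix for the order of the [b i]. *)
Let triangular (a : 'I_k -> 'F_2) :
    (forall i, i \notin J -> a i = 0) ->
    (forall j, j \in J ->
       a j = 0 \/ dotp (\sum_i a i *: w i) (delta j) = 0) ->
  forall i, a i = 0.
Proof.
move=> a0 aJ i; apply/eqP; case: eqP => // /eqP ai.
case: (arg_minnP (P := fun i => a i != 0) (fun i => r (b i)) ai) => j aj minj.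
have Jj : j \in J by apply: contraR aj => /a0 ->.
case: (aJ j Jj) => [aj0 | ]; first by rewrite aj0 eqxx in aj.
rewrite dotp_suml (bigD1 j) //= big1 => [|l lj].
  rewrite dotpZl /w Jj dotp_delta_b mulr1 addr0 => aj0.
  by rewrite aj0 eqxx in aj.
rewrite dotpZl; have [->|al] := eqVneq (a l) 0; first by rewrite mul0r.
have Jl : l \in J by apply: contraR al => /a0 ->.
rewrite /w Jl dotp_delta_later ?mulr0 // ltn_neqAle minj //.
by rewrite rank_neq // eq_sym.
Qed.

Let free_w (a : 'I_k -> 'F_2) : \sum_i a i *: w i = 0 -> forall i, a i = 0.
Proof.
move=> a0; apply: triangular => [i nJi | j _]; last by right; rewrite a0 dotp0l.
by rewrite -(dotp_w_e a nJi) a0 dotp0l.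
Qed.

Variable m : 'I_k.
Hypothesis Jm : m \in J.
Hypothesis min_m : forall j, j \in J -> (r (b m) <= r (b j))%N.

Lemma exists_peeled_vector : exists f,
  [/\ dotp f f = 1, forall i, i \notin J -> dotp f (e i) = 0
    & forall j (x : V j), j \in J -> j != m -> dotp (c x) f = 0].
Proof.
have [f dual_f] := free_dual free_w m; exists f.
have fb : dotp f (c (b m)) = 1 by have := dual_f m; rewrite /w Jm eqxx.
have f_e i : i \notin J -> dotp f (e i) = 0.
  move=> nJi; have := dual_f i; rewrite /w (negPf nJi) => ->.
  by case: eqP => // im; rewrite im Jm in nJi.
(* [c x] and [c (b m)] agree against every [w i] with [i != m]: later [b i] see both on the same
   side, and each [e i] is orthogonal to both. So they differ by a multiple of [f]. *)
have below (x : V m) : (r x <= r (b m))%N -> c x = c (b m) \/ c x = c (b m) + f.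
  move=> le_xb.
  have -> : c x = c (b m) + dotp (c x + c (b m)) (c (b m)) *: f.
    apply: F2_row_addr_eq0; apply: (free_separates free_w) => i.
    rewrite addrA (dotpDl (c x + c (b m))) dotpZl dual_f /w.
    have [-> | im] := eqVneq i m; first by rewrite Jm mulr1 F2_addrr.
    rewrite mulr0 addr0; case: ifP => [Ji | /negbT nJi]; last first.
      by rewrite dotpDl !perp_e // addr0.
    rewrite dotpDl !dotp_join 1?eq_sym //.
    have lt_mi : (r (b m) < r (b i))%N.
      by rewrite ltn_neqAle min_m // rank_neq // eq_sym.
    by rewrite lt_mi (leq_ltn_trans le_xb lt_mi) F2_addrr.
  case: (F2_cases (dotp (c x + c (b m)) (c (b m)))) => ->; [left|right].
    by rewrite scale0r addr0.
  by rewrite scale1r.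
have f_neq0 : f != 0 by apply/eqP => f0; move: fb; rewrite f0 dotp0l.
have perp_f j (x : V j) : j \in J -> j != m -> dotp (c x) f = 0.
  move=> Jj jm; case: (F2_cases (dotp (c x) f)) => // xf; exfalso.
  have [cyc qp qs qb maxb dp ds] := turnP m.
  (* [p m] and [s m] cannot both have vector [c (b m)], as their products with it differ. *)
  have [z qz zb] : exists2 z, z \in q m & c z != c (b m).
    have [pb | ] := eqVneq (c (p m)) (c (b m)); last by exists (p m).
    exists (s m) => //; apply/eqP => sb.
    by move: ds; rewrite sb -{1}pb dp.
  pose P (y : V m) := c y != c (b m).
  have beforeE y : y \in q m -> (r y < r x)%N = P y.
    move=> qy.
    (* Adding [f] flips the product with [c x], so [x] lies between [b m] and [y'] in the final
       order. *)
    have splitP (y' : V m) : y' \in q m -> P y' ->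
        (r (b m) < r x)%N = ~~ (r y' < r x)%N.
      move=> qy' Py'; have [y'b | y'b] := below _ (maxb _ qy').
        by rewrite /P y'b eqxx in Py'.
      have := dotpDl (c (b m)) f (c x); rewrite -y'b !dotp_join 1?eq_sym //.
      rewrite dotpC in xf; rewrite xf.
      by case: (m < j)%N; do 2!case: (_ < _)%N.
    have ltbx : (r (b m) < r x)%N = false.
      apply/negP => ltbx; have := splitP z qz zb.
      by rewrite ltbx (leq_ltn_trans (maxb _ qz) ltbx).
    have [Py | ] := boolP (P y).
      by have := splitP y qy Py; rewrite ltbx => /esym/negbFE.
    rewrite negbK => /eqP yb; rewrite -ltbx.
    have := congr1 (fun v => dotp v (c x)) yb.
    by rewrite /= !dotp_join 1?eq_sym // => /F2_natr_inj/addbI.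
  (* The vertices with vector [c (b m) + f] come before [x], those with vector [c (b m)] after
     it. *)
  apply: (cycle_not_separated (P := P) (t := dotp (c (b m) + f) (c (b m)))
            cyc qz zb qb); first by rewrite negbK.
  move=> y y' qy qy' Py nPy'; split.
    move: nPy'; rewrite negbK => /eqP ->.
    by have [yb | ->] := below _ (maxb _ qy); first by rewrite /P yb eqxx in Py.
  have lt_yx : (r y < r x)%N by rewrite beforeE.
  by rewrite (leq_trans lt_yx) // leqNgt beforeE.
split => //.
(* If [f] were isotropic, it would be a combination of the later [c (b j)]
   orthogonal to every [delta j]. *)
case: (F2_cases (dotp f f)) => // ff; exfalso.
have [a fa] := free_span free_w f.
have am : a m = 0.
  move: ff; rewrite {1}fa dotp_suml (bigD1 m) //= big1 => [|i im].
    by rewrite dotpZl dotpC dual_f eqxx mulr1 addr0.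
  by rewrite dotpZl dotpC dual_f (negPf im) mulr0.
have a0 : forall i, a i = 0.
  apply: triangular => [i nJi | j Jj]; first by rewrite -dotp_w_e // -fa f_e.
  have [-> | jm] := eqVneq j m; [by left | right].
  by rewrite -fa dotpDr !(dotpC f) !perp_f // addr0.
by move/eqP: f_neq0; apply; rewrite fa big1 // => i _; rewrite a0 scale0r.
Qed.

End Step.

(** Induction on [#|J|]: the vector of the factor with the earliest [b m] joins [e], and the
    hypotheses on [e] are the invariant. *)
Lemma factor_vectors (J : {set 'I_k}) (e : 'I_k -> 'rV['F_2]_k) :
    (forall i j, i \notin J -> j \notin J -> dotp (e i) (e j) = (i == j)%:R) ->
    (forall i j (x : V j), i \notin J -> j \in J -> dotp (c x) (e i) = 0) ->
  exists u : 'I_k -> 'rV['F_2]_k,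
    [/\ forall i, i \notin J -> u i = e i,
        forall i j, dotp (u i) (u j) = (i == j)%:R
      & forall j (x : V j), j \in J -> c x = 0 \/ c x = u j].
Proof.
have [n] := ubnP #|J|; elim: n J e => // n IHn J e ltJn on_e perp_e.
have [J0 | [j0 Jj0]] := set_0Vmem J.
  by exists e; split=> // [i j|j x]; [apply: on_e; rewrite J0 inE | rewrite J0 inE].
case: (arg_minnP (P := fun i => i \in J) (fun i => r (b i)) Jj0) => m Jm min_m.
have [f [ff f_e f_perp]] := exists_peeled_vector on_e perp_e Jm min_m.
pose e' i := if i == m then f else e i.
have [|i j||u [ue on_u uJ]] := IHn (J :\ m) e'.
- by move: ltJn; rewrite (cardsD1 m) Jm.
- rewrite !inE !negb_and !negbK /e'.
  have [-> _ | im /= nJi] := eqVneq i m; have [-> _ | jm /=] := eqVneq j m.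
  + by rewrite ff.
  + by move=> nJj; rewrite f_e.
  + by rewrite dotpC f_e // (negPf im).
  + by move=> nJj; apply: on_e.
- move=> i j x; rewrite !inE negb_and negbK /e' => iJ /andP[jm Jj].
  by case: eqP iJ => [_ _ | _ /= nJi]; [apply: f_perp | apply: perp_e].
exists u; split=> // [i nJi | j x Jj].
  have im : i != m by apply: contraNneq nJi => ->.
  by rewrite ue ?inE ?negb_and ?nJi ?orbT // /e' (negPf im).
have [jm | jm] := eqVneq j m; last by apply: uJ; rewrite !inE jm.
have u_neq0 i : u i != 0.
  by apply/eqP => u0; have := on_u i i; rewrite u0 dotp0l eqxx.
subst j.
have xu j : j != m -> dotp (c x) (u j) = 0.
  move=> jm; have [Jl | nJl] := boolP (j \in J); last first.
    rewrite ue ?inE ?negb_and ?nJl ?orbT //.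
    by rewrite /e' (negPf jm) perp_e.
  case: (F2_cases (dotp (c x) (u j))) => // xu1; exfalso.
  have {}uJ (y : V j) : c y = 0 \/ c y = u j by apply: uJ; rewrite !inE jm.
  have [cyc qp qs qb maxb dp ds] := turnP j.
  have bu : c (b j) = u j.
    by case: (uJ (b j)) => // b0; move: ds; rewrite b0 dotpC dotp0l.
  have p0 : c (p j) = 0.
    by case: (uJ (p j)) => // pu; move: dp; rewrite bu pu on_u eqxx.
  (* The side of [x] on which [y] lies decides whether [c y] is [0] or [u j]; the order of [m] and
     [j] decides which class comes first. *)
  have sideE (y : V j) : (m < j)%N (+) (r x < r y)%N = (c y != 0).
    have mj : m != j by rewrite eq_sym.
    apply: F2_natr_inj; rewrite -(dotp_join x y mj).
    case: (uJ y) => ->; first by rewrite eqxx dotpC dotp0l.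
    by rewrite u_neq0 xu1.
  have [lt_mj | le_jm] := boolP (m < j)%N.
    apply: (cycle_not_separated (P := fun y => c y != 0) (t := 0)
              cyc qb _ qp); rewrite ?bu ?p0 ?eqxx ?u_neq0 //.
    move=> y z _ _ cy cz; split; first by rewrite (eqP (negbNE cz)) dotpC dotp0l.
    have := sideE y; have := sideE z; rewrite lt_mj cy (negPf cz) /=.
    move=> /negbFE lt_xz; rewrite -leqNgt => le_yx.
    exact: leq_ltn_trans lt_xz.
  apply: (cycle_not_separated (P := fun y => c y == 0) (t := 0)
            cyc qp _ qb); rewrite ?bu ?p0 ?eqxx ?u_neq0 //.
  move=> y z _ _ cy cz; split; first by rewrite (eqP cy) dotp0l.
  have := sideE y; have := sideE z; rewrite (negPf le_jm) cy cz /=.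
  by move=> lt_xz /negbT; rewrite -leqNgt => le_yx; apply: leq_ltn_trans lt_xz.
(* The difference of the two sides is orthogonal to the whole basis [u]. *)
have -> : c x = dotp (c x) (u m) *: u m.
  apply: F2_row_addr_eq0; apply: (orthonormal_separates on_u) => i.
  rewrite dotpDl dotpZl on_u.
  have [-> | im] := eqVneq i m; first by rewrite mulr1 F2_addrr.
  by rewrite mulr0 addr0 xu.
case: (F2_cases (dotp (c x) (u m))) => ->; [left | right].
  by rewrite scale0r.
by rewrite scale1r.
Qed.

End Peel.

Lemma exists_factor_vectors :
    (forall i, ~~ acyclic (D i)) ->
  exists u : 'I_k -> 'rV['F_2]_k,
    (forall i j, dotp (u i) (u j) = (i == j)%:R) /\
    (forall i (x : V i), c x = 0 \/ c x = u i).
Proof.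
move=> cycD; have [t turnP] := fin_all_exists (fun i => exists_turn (cycD i)).
(* Initially no factor is peeled, so the conditions on [e] are vacuous. *)
have [|i j x|u [_ on_u uJ]] := factor_vectors turnP (J := setT) (e := fun=> 0).
- by move=> i j; rewrite inE.
- by rewrite inE.
by exists u; split=> // i x; apply: uJ; rewrite inE.
Qed.

End RankedJoin.

(** * Inversions as scalar products *)

Lemma inverts_edge (V : finType) (D : ograph V) (Xs : seq {set V}) u v :
  inverts D Xs u v =
    if odd (count (fun X : {set V} => (u \in X) && (v \in X)) Xs)
    then D v u else D u v.
Proof.
elim: Xs D => //= X Xs IHXs D; rewrite -/(inverts _ Xs) IHXs /= /invert_rel.
by rewrite oddD; case: (u \in X); case: (v \in X); case: odd.
Qed.

Lemma dotp_charvec (T : finType) k (X : k.-tuple {set T}) u v :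
  dotp (charvec X u) (charvec X v) =
    (odd (count (fun Y : {set T} => (u \in Y) && (v \in Y)) X))%:R.
Proof.
rewrite -F2_natr_odd -sum1_count big_tuple big_mkcond natr_sum.
by apply: eq_bigr => j _; rewrite !mxE -natrM mulnb; case: (_ && _).
Qed.

Lemma inverts_charvec (V : finType) (D : ograph V) k (X : k.-tuple {set V}) u v :
  inverts D X u v =
    if dotp (charvec X u) (charvec X v) == 0 then D u v else D v u.
Proof. by rewrite inverts_edge dotp_charvec; case: odd. Qed.

Lemma inversion_number1_not_acyclic (V : finType) (D : ograph V) :
  inversion_number D = 1%N -> ~~ acyclic D.
Proof.
rewrite /inversion_number; case: ex_minnP => n _ minn n1; apply/negP => acD.
have : (n <= 0)%N by apply: minn; apply/existsP; exists [tuple].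
by rewrite n1.
Qed.

Lemma orthonormal_familyP k l (u : 'I_l -> 'rV['F_2]_k) :
  orthonormal_family u <-> forall i j, dotp (u i) (u j) = (i == j)%:R.
Proof.
split=> [[u1 u0] i j | onu]; first by have [->|/u0] := eqVneq i j.
by split=> [i|i j /negPf ij]; rewrite onu ?eqxx ?ij.
Qed.

(** * Factorwise inversion of a k-join *)

Section KJoin.
Variables (k : nat) (V : 'I_k -> finType).
Implicit Types (D : forall i, ograph (V i)) (W : forall i, {set V i}).

Lemma kjoin_factor D i (x y : V i) :
  kjoin D (Tagged V x) (Tagged V y) = D i x y.
Proof. by rewrite /= /kjoin_rel /= ltnn eqxx tagged_asE. Qed.

Lemma kjoin_cross D i j (x : V i) (y : V j) :
  i != j -> kjoin D (Tagged V x) (Tagged V y) = (i < j)%N.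
Proof. by move=> /negPf ij; rewrite /= /kjoin_rel /= ij orbF. Qed.

Lemma kjoin_acyclic D : (forall i, acyclic (D i)) -> acyclic (kjoin D).
Proof.
move=> acD; have [r rD] := fin_all_exists (fun i => acyclic_rank (acD i)).
(* [M] exceeds every [r i x], which makes [rank] lexicographic. *)
pose M := (\sum_i \sum_(x : V i) (r i x).+1)%N.
have ltM i (x : V i) : (r i x < M)%N.
  by rewrite /M (bigD1 i) //= (bigD1 x) //= -addnA leq_addr.
pose rank (a : {i : 'I_k & V i}) := (tag a * M + r (tag a) (tagged a))%N.
apply: (rank_acyclic (r := rank)); rewrite {}/rank.
case=> i x [j y]; have [eij | ij] := eqVneq i j.
  by subst j; rewrite kjoin_factor /= ltn_add2l; apply: rD.
rewrite kjoin_cross //= => lt_ij.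
apply: leq_trans (leq_addr _ _); apply: leq_trans (_ : (i.+1 * M <= _)%N).
  by rewrite mulSn addnC ltn_add2r.
by rewrite leq_mul2r lt_ij orbT.
Qed.

(** By orthonormality, exactly the edges inside some [W i] are reversed. *)
Lemma inverts_kjoin D (X : k.-tuple {set {i : 'I_k & V i}})
    (u : 'I_k -> 'rV['F_2]_k) W :
    orthonormal_family u ->
    (forall i (v : V i), v \in W i -> charvec X (Tagged V v) = u i) ->
    (forall i (v : V i), v \notin W i -> charvec X (Tagged V v) = 0) ->
  inverts (kjoin D) X =2 kjoin (fun i => inverts (D i) [:: W i]).
Proof.
move=> /orthonormal_familyP onu uW u0 [i x] [j y]; rewrite inverts_charvec.
have [eij | ij] := eqVneq i j.
  subst j; rewrite !kjoin_factor /= /invert_rel.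
  have [Wx | nWx] := boolP (x \in W i); last by rewrite u0 // dotp0l.
  have [Wy | nWy] := boolP (y \in W i); last by rewrite dotpC u0 // dotp0l.
  by rewrite !uW // onu eqxx.
have -> : dotp (charvec X (Tagged V x)) (charvec X (Tagged V y)) = 0.
  have [Wx | nWx] := boolP (x \in W i); last by rewrite u0 // dotp0l.
  have [Wy | nWy] := boolP (y \in W j); last by rewrite dotpC u0 // dotp0l.
  by rewrite !uW // onu (negPf ij).
by rewrite eqxx !kjoin_cross.
Qed.

Lemma inverts_factor_sets D W :
  inverts (kjoin D) [seq factor_set (W i) | i <- enum 'I_k]
    =2 kjoin (fun i => inverts (D i) [:: W i]).
Proof.
pose X := [tuple factor_set (W i) | i < k].
have -> : [seq factor_set (W i) | i <- enum 'I_k] = X by rewrite -val_ord_tuple.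
have factor_setE i j (v : V j) :
    (Tagged V v \in factor_set (W i)) = (i == j) && (v \in W j).
  apply/imsetP/andP => [[x Wx def_v] | [/eqP-> Wv]]; last by exists v.
  have eij : j = i := congr1 tag def_v; subst j.
  by move/eqP: def_v; rewrite eq_Tagged /= => /eqP->; rewrite eqxx.
(* For the sets [factor_set (W i)] the orthonormal family is the standard basis. *)
apply: (@inverts_kjoin D X (delta_mx 0)).
- apply/orthonormal_familyP => i j; rewrite dotpE trmx_delta.
  by rewrite mul_delta_mx_cond mulmxnE mxE; case: eqP.
- move=> i v Wv; apply/rowP => j; rewrite !mxE tnth_mktuple factor_setE Wv andbT.
  by rewrite eqxx.
- move=> i v /negPf nWv; apply/rowP => j.
  by rewrite !mxE tnth_mktuple factor_setE nWv andbF.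
Qed.

End KJoin.

Theorem theorem1p5 (k : nat) (V : 'I_k -> finType)
    (D : forall i : 'I_k, ograph (V i))
    (invD : forall i : 'I_k, inversion_number (D i) = 1%N) :
  (forall X : k.-tuple {set {i : 'I_k & V i}},
     decycling_family (kjoin D) X <->
     exists (u : 'I_k -> 'rV['F_2]_k) (W : forall i : 'I_k, {set V i}),
       [/\ orthonormal_family u,
           forall i : 'I_k, decycling_set (D i) (W i),
           forall (i : 'I_k) (v : V i),
             v \in W i -> charvec X (Tagged V v) = u i
         & forall (i : 'I_k) (v : V i),
             v \notin W i -> charvec X (Tagged V v) = 0]) /\
  (forall X : k.-tuple {set {i : 'I_k & V i}},
     acyclic (inverts (kjoin D) X) ->
     exists W : forall i : 'I_k, {set V i},
       (forall i : 'I_k, decycling_set (D i) (W i)) /\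
       inverts (kjoin D) [seq factor_set (W i) | i <- enum 'I_k]
         =2 inverts (kjoin D) X).
Proof.
have cycD i := inversion_number1_not_acyclic (invD i).
have decyclingP (X : k.-tuple {set {i : 'I_k & V i}}) :
    decycling_family (kjoin D) X ->
    exists (u : 'I_k -> 'rV['F_2]_k) (W : forall i : 'I_k, {set V i}),
      [/\ orthonormal_family u,
          forall i : 'I_k, decycling_set (D i) (W i),
          forall (i : 'I_k) (v : V i),
            v \in W i -> charvec X (Tagged V v) = u i
        & forall (i : 'I_k) (v : V i),
            v \notin W i -> charvec X (Tagged V v) = 0].
  move=> /acyclic_rank[r rT].
  have rank a b : kjoin D a b ->
      if dotp (charvec X a) (charvec X b) == 0 then (r a < r b)%N
      else (r b < r a)%N.
    by move=> Dab; case: ifP => ab0; apply: rT; rewrite inverts_charvec ?ab0 //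
      dotpC ab0.
  have [|i j x y lt_ij|u [onu uX]] := exists_factor_vectors (D := D)
      (c := fun i x => charvec X (Tagged V x)) (r := fun i x => r (Tagged V x))
      _ _ cycD.
  - by move=> i x y Dxy; apply: rank; rewrite kjoin_factor.
  - by apply: rank; rewrite kjoin_cross // -(inj_eq val_inj) ltn_eqF.
  pose W i := [set v : V i | charvec X (Tagged V v) == u i].
  have onu' : orthonormal_family u by apply/orthonormal_familyP.
  have uW i (v : V i) : v \in W i -> charvec X (Tagged V v) = u i.
    by rewrite inE => /eqP.
  have u0 i (v : V i) : v \notin W i -> charvec X (Tagged V v) = 0.
    by rewrite inE; case: (uX i v) => [// | ->]; rewrite eqxx.
  exists u, W; split=> // i.
  (* The rank of the inverted join restricts to each inverted factor. *)
  apply: (rank_acyclic (r := fun v => r (Tagged V v))) => x y Dxy.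
  by apply: rT; rewrite (inverts_kjoin _ onu' uW u0) kjoin_factor.
split=> X; first split=> [/decyclingP // | [u [W [onu dW uW u0]]]].
  have [r rT] := acyclic_rank (kjoin_acyclic dW).
  by apply: (rank_acyclic (r := r)) => a b; rewrite (inverts_kjoin _ onu uW u0);
    apply: rT.
case/decyclingP => u [W [onu dW uW u0]]; exists W; split=> // a b.
by rewrite inverts_factor_sets (inverts_kjoin _ onu uW u0).
Qed.
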